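(* Let $F=L_n/L_0$, $L_0=k(x)$, be a cyclic extension of degree $p^n$ in which every ramified place is totally ramified, and let $P$ be a totally ramified place of $F$. Then the jumps of the ramification filtration at $P$ are exactly the integers $\lambda_\nu$, $1\le\nu\le n$, where $-\lambda_\nu$ is the valuation of the generator $y_\nu$ at the place $P_\nu$ of $L_\nu$ below $P$.
   Context: The constant field (also denoted $k$) is algebraically closed of characteristic $p>0$, and $F$ is the function field of a projective nonsingular curve of genus $\ge 2$. There is a unique tower $k(x)=L_0\subset L_1\subset\cdots\subset L_n=F$ with $[L_\nu:L_{\nu-1}]=p$, and generators are chosen in standard form: $L_\nu=L_{\nu-1}(y_\nu)$, $y_\nu^p-y_\nu=B_\nu\in L_{\nu-1}$, where $\mathrm{div}(B_\nu)=A-\sum_i\lambda_{i,\nu}P_{i,\nu-1}$, $A$ is effective and prime to the pole divisor of $B_\nu$, the $P_{i,\nu-1}$ are the places of $L_{\nu-1}$ above the places of $L_0$ ramified in $F/L_0$, and each $\lambda_{i,\nu}$ is zero or a positive integer prime to $p$. If $P$ lies above the $i_0$-th ramified place, $\lambda_\nu:=\lambda_{i_0,\nu}=-v_{P_\nu}(y_\nu)$. The ramification filtration (lower numbering) is $G_j(P)=\{\sigma\in \mathrm{Gal}(F/L_0): v_P(\sigma(t)-t)\ge j+1\}$ for a local uniformizer $t$ at $P$ (here $G_0(P)=G_1(P)=\mathrm{Gal}(F/L_0)$); an integer $j$ is a jump if $G_j(P)\supsetneq G_{j+1}(P)$. *)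

(* Defs.v *)
From HB Require Import structures.
From mathcomp Require Import all_boot all_order all_algebra all_fingroup all_field.
From mathcomp Require Import boolp freeg.

Set Implicit Arguments.
Unset Strict Implicit.
Unset Printing Implicit Defensive.

Import Order.TTheory GRing.Theory Num.Theory.
Local Open Scope ring_scope.

(* The rational function field k(x). *)
Notation ratfun k := {fraction {poly k}}.

Section Places.
Variables (k : closedFieldType) (F : splittingFieldType (ratfun k)).
Implicit Types (E : {subfield F}).

Definition const (c : k) : F := (tofrac c%:P)%:A.

(* A place of the intermediate field E, given by its normalized discrete
   valuation.  The function is defined on all of F so that places of different
   intermediate fields can be compared without casts; it is required to be 0
   outside E^*, so that equal valuations of E give equal records.  The value
   at 0 is therefore a dummy: "v(z) >= m", with v(0) = +oo, is [val_ge]. *)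
Record place E := Place {
  pval :> F -> int;
  pval_out : forall z, (z \notin E) || (z == 0) -> pval z = 0;
  pvalM : {in E &, forall a b, a != 0 -> b != 0 ->
            pval (a * b) = pval a + pval b};
  pvalD : {in E &, forall a b, a != 0 -> b != 0 -> a + b != 0 ->
            Num.min (pval a) (pval b) <= pval (a + b)};
  pval_const : forall c : k, pval (const c) = 0;
  pval_onto : exists2 t, t \in E & pval t = 1
}.

(* {freeg _ / _} needs a choiceType of keys. *)
HB.instance Definition _ E := gen_eqMixin (place E).
HB.instance Definition _ E := gen_choiceMixin (place E).

Definition val_ge E (Q : place E) (z : F) (m : int) : bool :=
  (z == 0) || (m <= Q z).

(* Q lies above P with ramification index e: v_Q = e v_P on E1.  As P is onto,
   this forces E1 to be contained in E2. *)
Definition ram_index E1 E2 (Q : place E2) (P : place E1) (e : nat) : Prop :=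
  (0 < e)%N /\ {in E1, forall z, Q z = e%:Z * P z}.

Definition lies_above E1 E2 (Q : place E2) (P : place E1) : Prop :=
  exists e, ram_index Q P e.

Definition ramified E (P : place E) : Prop :=
  exists Q : place {:F}%AS, exists2 e, ram_index Q P e & (1 < e)%N.

Definition totally_ramified E (P : place E) : Prop :=
  exists Q : place {:F}%AS, ram_index Q P (\dim_E {:F}).

Definition divisor E := {freeg (place E) / int}.

Definition effective E (D : divisor E) : Prop := forall Q, 0 <= coeff Q D.

(* D is the divisor of the nonzero function z. *)
Definition is_div E (z : F) (D : divisor E) : Prop :=
  [/\ z \in E, z != 0 & forall Q : place E, coeff Q D = Q z].

Definition prime_to_poles E (A : divisor E) (z : F) : Prop :=
  forall Q : place E, Q z < 0 -> coeff Q A = 0.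

(* The Riemann-Roch space L(D), and "L(D) has dimension d over k". *)
Definition in_RR (D : divisor {:F}) (f : F) : Prop :=
  forall Q : place {:F}, val_ge Q f (- coeff Q D).

Definition RR_dim (D : divisor {:F}) (d : nat) : Prop :=
  exists b : 'I_d -> F, (forall i, in_RR D (b i)) /\
    forall f, in_RR D f ->
      exists! c : {ffun 'I_d -> k}, f = \sum_(i < d) const (c i) * b i.

(* g is the maximum of deg D - dim L(D) + 1 over all divisors D of F.  All
   places have degree 1 because k is algebraically closed, so deg is the sum
   of the coefficients. *)
Definition is_genus (g : nat) : Prop :=
  (forall D d, RR_dim D d -> deg D - d%:Z + 1 <= g%:Z) /\
  (exists D, exists2 d, RR_dim D d & deg D - d%:Z + 1 = g%:Z).

(* The ramification filtration of Gal(F/E) at P in lower numbering, computed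
   with t, and its jumps. *)
Definition ram_group E (P : place {:F}) (t : F) (j : int) : {set gal_of {:F}} :=
  [set s in 'Gal({:F} / E)%g | val_ge P (s t - t) (j + 1)].

Definition is_jump E (P : place {:F}) (t : F) (j : int) : bool :=
  ram_group E P t (j + 1) \proper ram_group E P t j.

End Places.

(* Main.v *)
Require Import Defs.
From mathcomp Require Import all_boot all_order all_algebra all_fingroup all_solvable all_field.
From mathcomp Require Import boolp freeg zify ring.

(** Write [v] for the valuation at [P], [K] for [L nu], [E] for [L nu.+1],
    [y] for [y nu.+1], [N] for the degree of [F] over [E], and [lambda] for the
    corresponding pole order.  The heart of the matter is that every [s] which
    fixes [K] but not [E] satisfies [v (s t - t) = lambda + 1]
    ([artin_schreier_jump]).  The sets of such [s], one for each [nu], exhaust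
    the non-trivial elements of the Galois group, and so the jumps are read off
    from these valuations.

    All estimates rest on one remark: terms of distinct valuations cannot cancel
    ([val_ge_summand]).  If [v] takes on [K] only multiples of [d], and
    the integers [j * v x], for [j < e], are distinct modulo [d], then [x] has
    degree at least [e] over [K], and the valuation of a sum of terms [a_j x^j],
    with [a_j] in [K] and [j < e], is the least of their valuations.  This is
    used with [x = t] and with [x = y].

    Total ramification of [P] over [L 0] gives total ramification over every
    [L nu] ([totally_ramified_index]).  Hence the inertia group is everything
    ([val_ge_gal_sub]); as [s y - y] is a root of [X^p - X], hence a unit, [y]
    must have a pole at [P] ([val_artin_schreier]).  So [y ^+ p - y] has one,
    which the standard form identifies as a pole of order [lambda] prime to [p];
    this is the first assertion of the theorem.

    For the second one, the analogue for [E / K] of the claim is a direct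
    computation: expanding in powers of [y], the quantity [s z - z], for [z] an
    integer of [E], has valuation at least [N (lambda + 1)], with equality for a
    suitable uniformizer [tau^a y^j] of [E].  The passage from [E] to [F] is the
    classical comparison of the ramification numbers of a group and of a
    quotient: the sum over [h] in Gal(F/E) of the [v (s (h t) - t)] equals the
    valuation of [s u - u] at a uniformizer [u] of [E].  One inequality comes
    from evaluating at [t] the conjugate by [s] of the product of the
    [X - h t] ([leq_val_conjugates]), the other from writing [u = g(t)] and
    dividing [g(X) - s u] by the [X - s (h t)] ([geq_val_conjugates]).  Finally,
    the group is a cyclic p-group, so all the elements fixing [K] and not [E]
    generate the same subgroup; thus the [N] terms of the sum are equal, each
    being [lambda + 1]. *)

Set Implicit Arguments.
Unset Strict Implicit.
Unset Printing Implicit Defensive.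

Import Order.TTheory GRing.Theory Num.Theory.
Local Open Scope ring_scope.

(** * Ultrametric estimates *)

Section Valuation.
Variables (k : closedFieldType) (F : splittingFieldType (ratfun k)).
Variable v : place {:F}%AS.
Implicit Types (a b x z : F) (m : int).

Lemma val_mul a b : a != 0 -> b != 0 -> v (a * b) = v a + v b.
Proof. by move=> a0 b0; apply: pvalM; rewrite ?memvf. Qed.

Lemma val_one : v 1 = 0.
Proof. by have := pval_const v 1; rewrite /const polyC1 rmorph1 scale1r. Qed.

Lemma val_exp a j : a != 0 -> v (a ^+ j) = j%:Z * v a.
Proof.
move=> a0; elim: j => [|j IH]; first by rewrite expr0 val_one mul0r.
by rewrite exprS val_mul ?expf_neq0 // IH intS mulrDl mul1r.
Qed.

Lemma val_inv a : a != 0 -> v a^-1 = - v a.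
Proof.
move=> a0; apply/eqP; rewrite -addr_eq0 -val_mul ?invr_eq0 //.
by rewrite mulVf // val_one.
Qed.

Lemma val_opp a : v (- a) = v a.
Proof.
have [->|a0] := eqVneq a 0; first by rewrite oppr0.
have vN1 : v (-1) = 0.
  have := val_exp 2 (_ : (-1 : F) != 0); rewrite sqrrN expr1n val_one oppr_eq0 oner_eq0.
  by move=> /(_ isT) /esym; lia.
by rewrite -mulN1r val_mul ?oppr_eq0 ?oner_eq0 // vN1 add0r.
Qed.

Lemma val_ge_refl a : val_ge v a (v a).
Proof. by rewrite /val_ge lexx orbT. Qed.

Lemma val_ge0 m : val_ge v 0 m.
Proof. by rewrite /val_ge eqxx. Qed.

Lemma val_geE a m : a != 0 -> val_ge v a m = (m <= v a).
Proof. by rewrite /val_ge => /negPf ->. Qed.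

Lemma val_ge_le m1 m2 a : m1 <= m2 -> val_ge v a m2 -> val_ge v a m1.
Proof.
move=> le12; rewrite /val_ge => /orP[->//|h].
by rewrite (le_trans le12 h) orbT.
Qed.

Lemma val_geN a m : val_ge v (- a) m = val_ge v a m.
Proof. by rewrite /val_ge oppr_eq0 val_opp. Qed.

Lemma val_geD a b m : val_ge v a m -> val_ge v b m -> val_ge v (a + b) m.
Proof.
have [->|a0] := eqVneq a 0; first by rewrite add0r.
have [->|b0] := eqVneq b 0; first by rewrite addr0.
have [ab0|ab0] := eqVneq (a + b) 0; first by rewrite ab0 val_ge0.
rewrite !val_geE // => ha hb.
have := pvalD v (memvf a) (memvf b) a0 b0 ab0.
by apply: le_trans; rewrite le_min ha.
Qed.

Lemma val_geB a b m : val_ge v a m -> val_ge v b m -> val_ge v (a - b) m.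
Proof. by rewrite -(val_geN b); apply: val_geD. Qed.

Lemma val_geM a b m1 m2 :
  val_ge v a m1 -> val_ge v b m2 -> val_ge v (a * b) (m1 + m2).
Proof.
have [->|a0] := eqVneq a 0; first by rewrite mul0r => _ _; apply: val_ge0.
have [->|b0] := eqVneq b 0; first by rewrite mulr0 => _ _; apply: val_ge0.
by rewrite !val_geE ?mulf_neq0 // val_mul // => h1 h2; rewrite lerD.
Qed.

Lemma val_geX a m j : val_ge v a m -> val_ge v (a ^+ j) (j%:Z * m).
Proof.
move=> ha; elim: j => [|j IH]; first by rewrite expr0 val_geE ?oner_eq0 // val_one mul0r.
by rewrite exprS intS mulrDl mul1r; apply: val_geM.
Qed.

Lemma val_geM_int a b m : val_ge v a 0 -> val_ge v b m -> val_ge v (a * b) m.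
Proof. by move=> ha /(val_geM ha); rewrite add0r. Qed.

Lemma val_geX_int a j : val_ge v a 0 -> val_ge v (a ^+ j) 0.
Proof. by move/(val_geX j); rewrite mulr0. Qed.

Lemma val_ge_sum I (r : seq I) (Q : pred I) (w : I -> F) m :
  (forall i, Q i -> val_ge v (w i) m) -> val_ge v (\sum_(i <- r | Q i) w i) m.
Proof.
move=> h; elim/big_ind: _ => // [|a b]; [exact: val_ge0 | exact: val_geD].
Qed.

Lemma val_prod (I : finType) (Q : pred I) (w : I -> F) :
  (forall i, Q i -> w i != 0) -> v (\prod_(i | Q i) w i) = \sum_(i | Q i) v (w i).
Proof.
move=> h; pose K z m := z != 0 /\ v z = m.
suff [] : K (\prod_(i | Q i) w i) (\sum_(i | Q i) v (w i)) by [].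
elim/big_rec2: _ => [|i m z Qi [z0 <-]]; first by split; rewrite ?val_one ?oner_eq0.
by split; rewrite ?mulf_neq0 ?val_mul ?h.
Qed.

Lemma val_dominant a b :
  a != 0 -> val_ge v b (v a + 1) -> a + b != 0 /\ v (a + b) = v a.
Proof.
move=> a0 hb.
have sa : ~~ val_ge v a (v a + 1) by rewrite val_geE //; lia.
have ab0 : a + b != 0.
  by apply: contra sa; rewrite addr_eq0 => /eqP eab; rewrite {1}eab val_geN.
split=> //; apply/eqP; rewrite eq_le; apply/andP; split.
  rewrite leNgt; apply: contra sa => lt; rewrite -{1}[a](addrK b).
  by apply: val_geB => //; rewrite val_geE // lezD1.
rewrite -val_geE //; apply: val_geD; first exact: val_ge_refl.
by apply: val_ge_le hb; lia.
Qed.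

(** No cancellation can occur between terms of distinct valuations: a term of
    least valuation dominates the sum. *)
Lemma val_ge_summand (I : finType) (w : I -> F) m :
    (forall i j, w i != 0 -> w j != 0 -> v (w i) = v (w j) -> i = j) ->
  val_ge v (\sum_i w i) m -> forall i, val_ge v (w i) m.
Proof.
move=> inj hs i; apply/negPn/negP => hi.
have wi0 : w i != 0 by apply: contra hi => /eqP ->; exact: val_ge0.
rewrite val_geE // -ltNge in hi.
have [j wj0 jmin] : exists2 j, w j != 0 & forall l, w l != 0 -> v (w j) <= v (w l).
  by case: (@arg_minP _ int I i (fun l => w l != 0) (fun l => v (w l)) wi0) => j; exists j.
have [|s0 vs] := @val_dominant (w j) (\sum_(l | l != j) w l) wj0.
  apply: val_ge_sum => l lj; have [->|wl0] := eqVneq (w l) 0; first exact: val_ge0.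
  rewrite val_geE // -ltzD1 ltzD1 -[_ + 1]addrC lez1D lt_neqAle jmin // andbT.
  by apply: contra lj => /eqP /(inj _ _ wj0 wl0) ->.
rewrite (bigD1 j) //= val_geE // vs in hs.
by have := jmin i wi0; lia.
Qed.

(** ** Powers of an element as a valuation-orthogonal system *)

Section Powers.
Variables (K : {subfield F}) (x : F) (d e : nat).
Hypothesis Kd : {in K, forall z, (d %| v z)%Z}.
Hypothesis x0 : x != 0.
Hypothesis xe : forall j : nat, (0 < j < e)%N -> ~~ (d %| j%:Z * v x)%Z.

(** The nonzero terms of [g.[x]] have distinct valuations modulo [d]. *)
Lemma val_ge_horner (g : {poly F}) m :
    g \is a polyOver K -> (size g <= e)%N -> val_ge v g.[x] m ->
  forall j, val_ge v (g`_j * x ^+ j) m.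
Proof.
move=> /polyOverP gK sg; rewrite (horner_coef_wide _ sg) => h j.
have [je|ej] := ltnP j e; last first.
  by rewrite nth_default ?mul0r ?(leq_trans sg) //; apply: val_ge0.
have lem (i l : 'I_e) : g`_i * x ^+ i != 0 -> g`_l * x ^+ l != 0 ->
    v (g`_i * x ^+ i) = v (g`_l * x ^+ l) -> (i < l)%N -> False.
  rewrite !mulf_eq0 !negb_or => /andP[gi _] /andP[gl _].
  rewrite !val_mul ?expf_neq0 // !val_exp // => vE il.
  have /negP[] : ~~ (d %| (l - i)%N%:Z * v x)%Z.
    by apply: xe; rewrite subn_gt0 il (leq_ltn_trans (leq_subr _ _)).
  have -> : (l - i)%N%:Z * v x = v g`_i - v g`_l.
    by rewrite -subzn 1?ltnW // mulrBl; lia.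
  by rewrite rpredB ?Kd.
apply: (val_ge_summand (w := fun i : 'I_e => g`_i * x ^+ i) _ h (Ordinal je)).
move=> i l wi wl vE; apply: ord_inj.
case: (ltngtP i l) => // [/(lem _ _ wi wl vE)//|/(lem _ _ wl wi (esym vE))//].
Qed.

(** A polynomial over [K] of degree below [e] vanishing at [x] would have all its terms
    [g`_j * x ^+ j] of infinite valuation. *)
Lemma leq_adjoin_degree : (e <= adjoin_degree K x)%N.
Proof.
rewrite leqNgt; apply/negP => lt.
have := @val_ge_horner (minPoly K x) (v (x ^+ adjoin_degree K x) + 1) (minPolyOver K x).
rewrite size_minPoly => /(_ lt); rewrite minPolyxx => /(_ (val_ge0 _) (adjoin_degree K x)).
have := monicP (monic_minPoly K x); rewrite lead_coefE size_minPoly /= => ->.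
by rewrite mul1r val_geE ?expf_neq0 //; lia.
Qed.

Lemma leq_dim_over (E : {subfield F}) : (K <= E)%VS -> x \in E -> (e <= \dim_K E)%N.
Proof.
move=> KE xE; apply: leq_trans leq_adjoin_degree _.
by rewrite adjoin_degreeE leq_div2r // dimvS //; apply/FadjoinP.
Qed.

Lemma adjoin_full (E : {subfield F}) :
  (K <= E)%VS -> x \in E -> (\dim_K E <= e)%N -> <<K; x>>%VS = E.
Proof.
move=> KE xE le; apply/eqP; rewrite eqEdim; apply/andP; split; first exact/FadjoinP.
by rewrite dim_Fadjoin (dim_sup_field KE) leq_mul2r (leq_trans le leq_adjoin_degree) orbT.
Qed.

Lemma power_expansion z :
    z \in <<K; x>>%VS -> (adjoin_degree K x <= e)%N ->
  exists g : {poly F}, [/\ g \is a polyOver K, (size g <= e)%N, z = g.[x] &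
    forall m, val_ge v z m -> forall j, val_ge v (g`_j * x ^+ j) m].
Proof.
move=> zKx le; exists (Fadjoin_poly K x z).
have sg : (size (Fadjoin_poly K x z) <= e)%N by apply: leq_trans (size_Fadjoin_poly K x z) le.
split; rewrite ?Fadjoin_polyOver ?Fadjoin_poly_eq //.
by move=> m zm; apply: val_ge_horner; rewrite ?Fadjoin_polyOver ?Fadjoin_poly_eq.
Qed.

End Powers.

(** If [x - 1] is small then so are the [x ^+ j - 1], and no smaller when [j]
    is a unit, as [x ^+ j - 1 = (x - 1) * \sum_(i < j) x ^+ i] and the sum is
    congruent to [j]. *)
Lemma val_unipotent x j m :
    0 < m -> val_ge v (x - 1) m ->
  val_ge v (x ^+ j - 1) m /\
  (x != 1 -> j%:R != 0 :> F -> v j%:R = 0 ->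
    x ^+ j - 1 != 0 /\ v (x ^+ j - 1) = v (x - 1)).
Proof.
move=> m0 hx.
have ge1 i : val_ge v (x ^+ i - 1) m.
  elim: i => [|i IH]; first by rewrite expr0 subrr; apply: val_ge0.
  have -> : x ^+ i.+1 - 1 = (x - 1) * (x ^+ i - 1) + ((x - 1) + (x ^+ i - 1)).
    by rewrite exprS; ring.
  apply: val_geD; last exact: val_geD.
  by apply: val_ge_le (val_geM hx IH); lia.
split=> // x1 j0 vj.
have -> : x ^+ j - 1 = (x - 1) * \sum_(i < j) x ^+ i by rewrite subrX1.
have [|s0 vs] := @val_dominant j%:R (\sum_(i < j) (x ^+ i - 1)) j0.
  by apply: val_ge_sum => i _; apply: val_ge_le (ge1 i); rewrite vj; lia.
rewrite sumrB sumr_const card_ord addrC subrK in s0 vs.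
by rewrite mulf_neq0 ?val_mul ?subr_eq0 // vs vj addr0.
Qed.

(** Synthetic division by monic linear factors keeps a polynomial integral. *)
Lemma val_ge_horner_roots (g : {poly F}) (rs : seq F) x :
    (forall i, val_ge v g`_i 0) -> uniq rs -> all (root g) rs ->
    all (val_ge v ^~ 0) rs -> val_ge v x 0 ->
    x \notin rs -> 
  val_ge v g.[x] (\sum_(r <- rs) v (x - r)).
Proof.
move=> gi urs rg ri xi xrs.
elim: rs g gi urs rg ri xrs => [|r rs IH] g gi.
  move=> _ _ _ _; rewrite big_nil horner_coef; apply: val_ge_sum => i _.
  by apply: val_geM_int => //; apply: val_geX_int.
move=> /=/andP[rrs urs] /andP[/factor_theorem[q gq] rg] /andP[rint ri].
rewrite inE negb_or => /andP[xr xrs].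
have qi i : val_ge v q`_i 0.
  have [n] : exists n, (size q <= n + i)%N by exists (size q); apply: leq_addr.
  elim: n i => [|n IHn] i le; first by rewrite nth_default ?val_ge0.
  have -> : q`_i = g`_i.+1 + r * q`_i.+1.
    by rewrite gq mulrBr coefB coefMX coefMC /= mulrC subrK.
  apply: val_geD => //; apply: val_geM_int => //.
  by apply: IHn; rewrite addnS.
rewrite gq hornerM hornerXsubC big_cons mulrC; apply: val_geM.
  exact: val_ge_refl.
apply: IH => //; apply/allP => s srs; have := allP rg s srs.
rewrite gq rootM root_XsubC => /orP[//|/eqP sr].
by rewrite -sr srs in rrs.
Qed.

End Valuation.

(** * Action of the Galois group *)

Lemma dvdz_add_gt0 (d j : nat) (a : int) :
  (d %| a)%Z -> (0 < j < d)%N -> 0 <= a + j%:Z -> 1 <= a + j%:Z.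
Proof.
move=> da /andP[j0 jd]; rewrite le_eqVlt => /orP[/eqP e|//].
have : (d %| j%:Z)%Z.
  by rewrite -(rpredDl _ da) -e dvdz0.
by rewrite dvdzE /= gtnNdvd.
Qed.

Lemma dvdz_add_ge0 (d j : nat) (a : int) :
  (d %| a)%Z -> (j < d)%N -> 0 <= a + j%:Z -> 0 <= a.
Proof.
case/dvdzP=> q -> jd ge0; have d0 : (0 < d)%N by apply: leq_ltn_trans jd.
have : 0 < (q + 1) * d%:Z by rewrite mulrDl mul1r; apply: le_lt_trans ge0 _; rewrite ltrD2l.
by rewrite pmulr_lgt0 // ltzD1 => q0; rewrite mulr_ge0.
Qed.

Section GaloisAction.
Variables (k : closedFieldType) (F : splittingFieldType (ratfun k)).
Variable v : place {:F}%AS.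
Implicit Types (K E : {subfield F}) (s h : gal_of {:F}).
Hypothesis vG : forall s z, s \in 'Gal({:F} / 1%AS)%g -> v (s z) = v z.

Lemma gal_sub1 K : 'Gal({:F} / K)%g \subset 'Gal({:F} / 1%AS)%g.
Proof. by rewrite galS ?sub1v. Qed.

Lemma val_ge_gal s z m : s \in 'Gal({:F} / 1%AS)%g -> val_ge v (s z) m = val_ge v z m.
Proof. by move=> sG; rewrite /val_ge fmorph_eq0 vG. Qed.

(** The inertia group is everything when [F] is totally ramified over [K]: in
    the expansion of [z] in powers of [t], all the terms but the constant one,
    which [s] fixes, vanish at the place. *)
Lemma val_ge_gal_sub K (d : nat) t s z :
    {in K, forall a, (d %| v a)%Z} -> (\dim_K {:F} <= d)%N -> v t = 1 ->
    s \in 'Gal({:F} / K)%g -> val_ge v z 0 ->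
  val_ge v (s z - z) 1.
Proof.
move=> Kd dimd vt sK z0.
have s1 := subsetP (gal_sub1 K) s sK.
have t0 : t != 0 by apply/eqP => t0; move: vt; rewrite t0 pval_out // eqxx orbT.
have td (j : nat) : (0 < j < d)%N -> ~~ (d %| j%:Z * v t)%Z.
  by move=> /andP[j0 jd]; rewrite vt mulr1 dvdzE /= gtnNdvd.
have Kt : <<K; t>>%VS = fullv by apply: (adjoin_full Kd t0 td (E := {:F}%AS)); rewrite ?subvf ?memvf.
have [||g [/polyOverP gK' sg zg gM]] := @power_expansion _ _ v K t d d Kd t0 td z.
- by rewrite Kt memvf.
- by rewrite adjoin_degreeE Kt.
have gK j : g`_j \in K := gK' j.
rewrite zg horner_coef rmorph_sum -sumrB; apply: val_ge_sum => -[j /= _] _.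
have sg_j := fixed_gal (subvf K) sK (gK j).
rewrite rmorphM rmorphXn /= sg_j.
have [->|j0] := posnP j; first by rewrite !expr0 subrr; apply: val_ge0.
have [->|gj0] := eqVneq g`_j 0; first by rewrite !mul0r subrr; apply: val_ge0.
have jd : (j < d)%N by rewrite ltnNge; apply: contra gj0 => dj; rewrite nth_default ?(leq_trans sg).
have w1 : val_ge v (g`_j * t ^+ j) 1.
  have := gM 0 z0 j; rewrite !val_geE ?mulf_neq0 ?expf_neq0 // val_mul ?expf_neq0 // val_exp // vt.
  by rewrite mulr1; apply: dvdz_add_gt0 (Kd _ (gK j)) _; rewrite j0.
apply: val_geB => //; move: w1.
by rewrite -(val_ge_gal _ _ s1) rmorphM rmorphXn /= sg_j.
Qed.

(** Let [f] be the product of the [X - h t]; it has coefficients in the ring of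
    integers of [K], so its coefficients move by at least [m] under [s].  As [t]
    is a root of [f], the conjugate of [f] by [s] then takes at [t] a value of
    valuation at least [m], and this value is the product of the
    [t - s (h t)]. *)
Lemma leq_val_conjugates K s t (i m : int) :
    galois 1%AS {:F} -> s \in 'Gal({:F} / 1%AS)%g -> val_ge v t 0 ->
    {in 'Gal({:F} / K)%g, forall h, s (h t) != t /\ v (s (h t) - t) = i} ->
    {in K, forall z, val_ge v z 0 -> val_ge v (s z - z) m} ->
  m <= #|'Gal({:F} / K)%g|%:Z * i.
Proof.
move=> gal1 sG t0 hi hm.
set H := 'Gal({:F} / K)%g in hi *.
have galK : galois K {:F} by apply: galoisS gal1; rewrite sub1v subvf.
pose f := \prod_(h in H) ('X - (h t)%:P).
have fi j : val_ge v f`_j 0.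
  rewrite /f; elim/big_rec: _ j => [|h q hH IH] j.
    by rewrite coef1; case: eqP => _; rewrite ?val_ge0 // val_geE ?oner_eq0 ?val_one.
  rewrite mulrBl coefB coefXM coefCM; apply: val_geB.
    by case: ifP => _ //; apply: val_ge0.
  by apply: val_geM_int => //; rewrite val_ge_gal ?(subsetP (gal_sub1 K)).
(* [f] is invariant under Gal(F/K), which permutes its factors *)
have fK j : f`_j \in K.
  suff : f`_j \in fixedField H by rewrite (galois_fixedField galK).
  apply/fixedFieldP; rewrite ?memvf // => x xH; rewrite -coef_map /=.
  suff -> : map_poly x f = f by [].
  rewrite /f rmorph_prod [RHS](reindex_inj (mulIg x)) /=.
  apply: eq_big => [h|h hH]; first by rewrite groupMr.
  by rewrite rmorphB /= map_polyX map_polyC /= galM ?memvf.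
have ft0 : f.[t] = 0.
  by rewrite /f horner_prod (bigD1 1%g) //= hornerXsubC gal_id subrr mul0r.
have sft : (map_poly s f).[t] = \prod_(h in H) (t - s (h t)).
  rewrite /f rmorph_prod horner_prod; apply: eq_bigr => h _.
  by rewrite rmorphB /= map_polyX map_polyC hornerXsubC.
have nz h : h \in H -> t - s (h t) != 0 by move/hi => [] h0 _; rewrite subr_eq0 eq_sym.
have : val_ge v (map_poly s f).[t] m.
  rewrite -[_.[t]]subr0 -ft0 -hornerN -hornerD horner_coef; apply: val_ge_sum => j _.
  rewrite coefB coef_map mulrC; apply: val_geM_int; first exact: val_geX_int.
  exact: hm.
rewrite sft val_geE; last by apply/prodf_neq0.
rewrite val_prod // (eq_bigr (fun=> i)) => [|h /hi[_ <-]].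
  by rewrite sumr_const -mulr_natl natz.
by rewrite -val_opp opprB.
Qed.

(** The polynomial [g(X) - s u] has the distinct roots [s (h t)], as
    [g (s (h t)) = s (h u) = s u], and integral coefficients.  So its value
    [u - s u] at [t] is an integral multiple of the product of the
    [t - s (h t)]. *)
Lemma geq_val_conjugates K s t u (i : int) (g : {poly F}) :
    s \in 'Gal({:F} / 1%AS)%g -> val_ge v t 0 ->
    {in 'Gal({:F} / K)%g, forall h, s (h t) != t /\ v (s (h t) - t) = i} ->
    {in 'Gal({:F} / K)%g &, injective (fun h => h t)} ->
    u \in K -> s u != u -> u = g.[t] -> (forall j, val_ge v g`_j 0) ->
    map_poly s g = g -> {in 'Gal({:F} / K)%g, forall h, map_poly h g = g} ->
  #|'Gal({:F} / K)%g|%:Z * i <= v (s u - u).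
Proof.
move=> sG t0 hi inj uK su ug gi sg hg.
set H := 'Gal({:F} / K)%g in hi inj hg *.
have ui : val_ge v u 0.
  by rewrite ug horner_coef; apply: val_ge_sum => j _; apply: val_geM_int => //; apply: val_geX_int.
pose rs := [seq s (h t) | h <- enum H].
suff : val_ge v (u - s u) (\sum_(r <- rs) v (t - r)).
  rewrite val_geE ?subr_eq0 1?eq_sym // -[v (s u - u)]val_opp opprB.
  congr (_ <= _); rewrite /rs big_map big_enum /= (eq_bigr (fun=> i)).
    by rewrite sumr_const -mulr_natl natz.
  by move=> h /hi[_ <-]; rewrite -val_opp opprB.
have -> : u - s u = (g - (s u)%:P).[t] by rewrite hornerD hornerN hornerC -ug.
apply: val_ge_horner_roots => //.
- move=> j; rewrite coefB coefC; apply: val_geB => //.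
  by case: ifP => _; rewrite ?val_ge_gal ?val_ge0.
- rewrite map_inj_in_uniq ?enum_uniq // => h h'; rewrite !mem_enum => hH h'H.
  by move=> /fmorph_inj; apply: inj.
- apply/allP => r /mapP[h]; rewrite mem_enum => hH ->.
  rewrite rootE hornerD hornerN hornerC -{1}sg -{1}(hg h hH) !horner_map /= -ug.
  by rewrite (fixed_gal (subvf K) hH uK) subrr.
- apply/allP => r /mapP[h]; rewrite mem_enum => hH ->.
  by rewrite (val_ge_gal _ _ sG) (val_ge_gal _ _ (subsetP (gal_sub1 K) h hH)).
by apply/mapP => -[h]; rewrite mem_enum => /hi[+ _] e; rewrite -e eqxx.
Qed.

End GaloisAction.

(** * A step of an Artin-Schreier tower *)

Section ArtinSchreierStep.
Variables (k : closedFieldType) (F : splittingFieldType (ratfun k)).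
Variable v : place {:F}%AS.
Implicit Types (s h : gal_of {:F}).
Hypothesis vG : forall s z, s \in 'Gal({:F} / 1%AS)%g -> v (s z) = v z.

Lemma val_neq0 z : v z != 0 -> z != 0.
Proof. by apply: contra => /eqP ->; rewrite pval_out // eqxx orbT. Qed.

Lemma gal_inj_on (K : {subfield F}) (t : F) : <<K; t>>%VS = fullv ->
  {in 'Gal({:F} / K)%g &, injective (fun h => h t)}.
Proof.
move=> Kt h h' hK h'K ht; apply/eqP/gal_eqP => z _.
have zKt : z \in <<K; t>>%VS by rewrite Kt memvf.
have [q qK ->] := Fadjoin_polyP zKt.
by rewrite -!horner_map !(fixedPoly_gal (subvf K)) //= ht.
Qed.

(** Here [<<K; y>>] is a step of degree [p] over [K], ramified at [v], and [N] is
    the ramification index of [F] over it; [s y - y] is a unit.  The valuations of the powers of [y] below the [p]-th are distinct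
    modulo [p * N], as [lam] is prime to [p]. *)
Variables (K : {subfield F}) (y : F) (p N lam : nat) (s : gal_of {:F}).
Hypotheses (p_pr : prime p) (N0 : (0 < N)%N) (lam0 : (0 < lam)%N) (plam : coprime p lam).
Hypothesis Kd : {in K, forall a, ((p * N)%N %| v a)%Z}.
Hypothesis degy : (adjoin_degree K y <= p)%N.
Hypothesis vy : v y = - (lam * N)%N%:Z.
Hypothesis sK : s \in 'Gal({:F} / K)%g.
Hypothesis sy : s y != y.
Hypothesis vsy : v (s y - y) = 0.
Hypothesis val_nat_unit : forall j : nat, coprime p j -> j%:R != 0 :> F /\ v j%:R = 0.

Let y0 : y != 0.
Proof. by apply: val_neq0; rewrite vy oppr_eq0 -lt0n muln_gt0 lam0. Qed.

Let s1 : s \in 'Gal({:F} / 1%AS)%g.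
Proof. exact: subsetP (gal_sub1 K) s sK. Qed.

Let sterm a j : a \in K -> s (a * y ^+ j) - a * y ^+ j = a * y ^+ j * ((s y / y) ^+ j - 1).
Proof.
move=> aK; rewrite rmorphM rmorphXn /= (fixed_gal (subvf K) sK aK).
by rewrite mulrBr mulr1 expr_div_n mulrA mulrAC mulfK ?expf_neq0 //; rewrite mulrAC.
Qed.

Let sy1 : s y / y - 1 = (s y - y) / y.
Proof. by rewrite mulrBl mulfV. Qed.

Let vsy1 : v (s y / y - 1) = (lam * N)%N%:Z.
Proof. by rewrite sy1 val_mul ?invr_eq0 ?subr_eq0 // val_inv // vsy vy opprK add0r. Qed.

Let uni : val_ge v (s y / y - 1) (lam * N)%N%:Z.
Proof. by rewrite -vsy1; apply: val_ge_refl. Qed.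

Let lamN0 : 0 < (lam * N)%N%:Z :> int.
Proof. by rewrite ltz_nat muln_gt0 lam0. Qed.

Let ypow (j : nat) : (0 < j < p)%N -> ~~ ((p * N)%N %| j%:Z * v y)%Z.
Proof.
move=> /andP[j0 jp]; rewrite vy mulrN dvdzE abszN -PoszM absz_nat /= mulnA.
rewrite dvdn_pmul2r // Gauss_dvdl // gtnNdvd //.
Qed.

(** Write [z] as a sum of terms [a * y ^+ j], each of them integral.  For [j > 0]
    the valuation of such a term is a multiple of [N] other than 0, so at least
    [N]; and the action of [s] multiplies the term by [(s y / y) ^+ j], which is
    congruent to 1 up to valuation [lam * N]. *)
Lemma val_ge_step_sub z :
  z \in <<K; y>>%VS -> val_ge v z 0 -> val_ge v (s z - z) (N%:Z * (lam%:Z + 1)).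
Proof.
move=> zKy z0.
have [g [/polyOverP gK' sg zg gM]] := power_expansion Kd y0 ypow zKy degy.
have gK j : g`_j \in K := gK' j.
rewrite zg horner_coef rmorph_sum -sumrB; apply: val_ge_sum => -[j /= _] _.
rewrite (sterm _ (gK j)).
have [->|j0] := posnP j; first by rewrite !expr0 subrr mulr0; apply: val_ge0.
have [->|gj0] := eqVneq g`_j 0; first by rewrite !mul0r; apply: val_ge0.
have jp : (j < p)%N by rewrite ltnNge; apply: contra gj0 => dj; rewrite nth_default ?(leq_trans sg).
have wN : val_ge v (g`_j * y ^+ j) N.
  have := gM 0 z0 j; rewrite !val_geE ?mulf_neq0 ?expf_neq0 // val_mul ?expf_neq0 // val_exp //.
  have Nd : (N %| v g`_j + j%:Z * v y)%Z.
    rewrite rpredD // ?vy ?mulrN ?rpredN ?dvdz_mull ?PoszM ?dvdz_mull //.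
    by apply: dvdz_trans (Kd (gK j)); rewrite PoszM dvdz_mull.
  have nz : v g`_j + j%:Z * v y != 0.
    apply/eqP => e; have := ypow (j := j); rewrite j0 jp => /(_ isT)/negP; apply.
    by rewrite -(rpredDl _ (Kd (gK j))) e dvdz0.
  move=> ge0; case/dvdzP: Nd ge0 nz => q ->; rewrite pmulr_lge0 ?ltz_nat //.
  by rewrite mulf_eq0 negb_or => q0 /andP[q1 _]; rewrite ler_peMl // -gtz0_ge1 lt_def q1.
have -> : N%:Z * (lam%:Z + 1) = N%:Z + (lam * N)%N%:Z by clear; lia.
by apply: val_geM => //; have [] := val_unipotent j lamN0 uni.
Qed.

(** Bezout coefficients of [p] and [lam] give a uniformizer of the form
    [tau ^+ a * y ^+ j]; there the bound of [val_ge_step_sub] is attained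
    because [j] is prime to [p]. *)
Lemma step_uniformizer tau : tau \in K -> v tau = (p * N)%N ->
  exists u, [/\ u \in <<K; y>>%VS, v u = N, s u != u & v (s u - u) = N%:Z * (lam%:Z + 1)].
Proof.
move=> tauK vtau; have tau0 : tau != 0 by apply: val_neq0; rewrite vtau -lt0n muln_gt0 prime_gt0.
case: (egcdnP lam (prime_gt0 p_pr)) => a j; rewrite (eqP plam) => aj _.
have pj : coprime p j.
  by apply/coprimeP; rewrite ?prime_gt0 //; exists (a, lam); rewrite aj mulnC addKn.
have [j0 vj] := val_nat_unit pj.
have w0 : tau ^+ a * y ^+ j != 0 by rewrite mulf_neq0 ?expf_neq0.
have vw : v (tau ^+ a * y ^+ j) = N.
  rewrite val_mul ?expf_neq0 // !val_exp // vtau vy.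
  have : ((a * p) * N = (j * lam + 1) * N)%N by rewrite aj.
  by clear; nia.
exists (tau ^+ a * y ^+ j).
have [_ /(_ _ j0 vj)[]] := val_unipotent j lamN0 uni.
  by rewrite -subr_eq0; apply: val_neq0; rewrite vsy1 gt_eqF.
rewrite -(subr_eq0 (s _)) sterm ?rpredX // => nz vE.
split=> //; last 2 first.
- by rewrite mulf_neq0.
- by rewrite val_mul // vw vE vsy1; clear; lia.
by rewrite rpredM ?rpredX ?memv_adjoin // (subvP (subv_adjoin K y)).
Qed.

(** By the two comparison lemmas for conjugates, [N * i] is squeezed between two
    copies of [N * (lam + 1)]. *)
Lemma artin_schreier_jump (E : {subfield F}) tau t (i : int) :
    galois 1%AS {:F} -> E = <<K; y>>%AS -> (\dim_K {:F} <= p * N)%N ->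
    #|'Gal({:F} / E)%g| = N -> tau \in K -> v tau = (p * N)%N -> v t = 1 ->
    {in 'Gal({:F} / E)%g, forall h, s (h t) != t /\ v (s (h t) - t) = i} ->
  i = lam%:Z + 1.
Proof.
move=> gal1 EKy dimF cardE tauK vtau vt hi.
have KE : (K <= E)%VS by rewrite EKy subv_adjoin.
have t0 : t != 0 by apply: val_neq0; rewrite vt.
have tint : val_ge v t 0 by rewrite val_geE // vt.
have td (j : nat) : (0 < j < p * N)%N -> ~~ ((p * N)%N %| j%:Z * v t)%Z.
  by move=> /andP[j0 jd]; rewrite vt mulr1 dvdzE /= gtnNdvd.
have Kt : <<K; t>>%VS = fullv.
  by apply: (adjoin_full Kd t0 td (E := {:F}%AS)); rewrite ?subvf ?memvf.
have [u [uE vu su vsu]] := step_uniformizer tauK vtau.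
have [||g [gK sg ug gM]] := power_expansion Kd t0 td (z := u).
- by rewrite Kt memvf.
- by rewrite adjoin_degreeE Kt.
have uint : val_ge v u 0 by rewrite /val_ge vu orbT.
(* [v g`_j] is a multiple of [p * N] which is at least [- j > - (p * N)] *)
have gint j : val_ge v g`_j 0.
  have [->|gj0] := eqVneq g`_j 0; first exact: val_ge0.
  have jd : (j < p * N)%N.
    by rewrite ltnNge; apply: contra gj0 => dj; rewrite nth_default ?(leq_trans sg).
  have := gM 0 uint j; rewrite !val_geE ?mulf_neq0 ?expf_neq0 // val_mul ?expf_neq0 // val_exp //.
  by rewrite vt mulr1; apply: dvdz_add_ge0 (Kd (polyOverP gK j)) jd.
have hK : {in 'Gal({:F} / E)%g, forall h, h \in 'Gal({:F} / K)%g}.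
  by apply/subsetP; apply: galS.
apply/eqP; rewrite eq_le; apply/andP; split.
  have := geq_val_conjugates vG s1 tint hi.
  have inj : {in 'Gal({:F} / E)%g &, injective (fun h => h t)}.
    by move=> h h' /hK hh /hK hh'; apply: (gal_inj_on Kt).
  have uE' : u \in E by rewrite EKy.
  move=> /(_ u g inj uE' su ug gint); rewrite cardE vsu.
  rewrite ler_pM2l ?ltz_nat //; apply; first exact: fixedPoly_gal (subvf K) sK gK.
  by move=> h hE; apply: fixedPoly_gal (subvf K) _ gK; apply: hK.
have := leq_val_conjugates vG gal1 s1 tint hi.
rewrite cardE => /(_ (N%:Z * (lam%:Z + 1))); rewrite ler_pM2l ?ltz_nat //; apply.
by move=> z; rewrite EKy; apply: val_ge_step_sub.
Qed.

End ArtinSchreierStep.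

(** * Places of intermediate fields *)

Section Ramification.
Variables (k : closedFieldType) (F : splittingFieldType (ratfun k)).
Implicit Types (K E : {subfield F}).

Lemma place_ext E (Q Q' : place E) : Q =1 Q' -> Q = Q'.
Proof.
case: Q Q' => [f1 a1 b1 c1 d1 e1] [f2 a2 b2 c2 d2 e2] /= /funext fE.
by case: _ / fE in a2 b2 c2 d2 e2 *; congr Place; apply: Prop_irrelevance.
Qed.

(** The index is determined as the positive generator of the values of [v] on
    [K]. *)
Lemma ram_index_inj K E (v : place E) (Q Q' : place K) (e e' : nat) :
  ram_index v Q e -> ram_index v Q' e' -> Q = Q'.
Proof.
move=> [e0 vQ] [e'0 vQ']; have ee' : e = e'.
  have [a aE Qa] := pval_onto Q; have [b bE Qb] := pval_onto Q'.
  apply/eqP; rewrite eqn_dvd; apply/andP; split.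
    by have := vQ b bE; rewrite vQ' // Qb mulr1 => /(congr1 absz); rewrite abszM /= => ->; apply: dvdn_mulr.
  by have := vQ a aE; rewrite vQ' // Qa mulr1 => /(congr1 absz); rewrite abszM /= => <-; apply: dvdn_mulr.
apply: place_ext => z; have [zE|zE] := boolP (z \in K); last by rewrite !pval_out ?zE.
have : e%:Z != 0 by rewrite -lt0n.
by move/mulfI; apply; rewrite -vQ // ee' -vQ'.
Qed.

Lemma dim_over_tower K E : (K <= E)%VS ->
  \dim_K {:F} = (\dim_K E * \dim_E {:F})%N.
Proof.
move=> KE; apply/eqP; rewrite -(eqn_pmul2r (adim_gt0 K)) -dim_sup_field ?subvf //.
by rewrite mulnAC -dim_sup_field // mulnC -dim_sup_field ?subvf.
Qed.

(** The ramification indices over [E] and of [E] over [K] are bounded by the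
    corresponding degrees, and their product attains the product of these. *)
Lemma totally_ramified_index K E (v : place {:F}%AS) (P0 : place K) (Q : place E) e :
    (K <= E)%VS -> ram_index v P0 (\dim_K {:F}) -> ram_index v Q e ->
  e = \dim_E {:F}.
Proof.
move=> KE [d0 vP0] [e0 vQ].
have [t _ vt] := pval_onto v; have t0 : t != 0 by apply: (val_neq0 (v := v)); rewrite vt.
have [x xE Qx] := pval_onto Q; have vx : v x = e by rewrite vQ // Qx mulr1.
have x0 : x != 0 by apply: (val_neq0 (v := v)); rewrite vx -lt0n.
have Ed : {in E, forall z, (e %| v z)%Z} by move=> z /vQ ->; apply: dvdz_mulr.
have Kd : {in K, forall z, (\dim_K {:F} %| v z)%Z} by move=> z /vP0 ->; apply: dvdz_mulr.
have leF : (e <= \dim_E {:F})%N.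
  apply: (leq_dim_over Ed t0) => [j /andP[j0 je]||]; rewrite ?subvf ?memvf //.
  by rewrite vt mulr1 dvdzE /= gtnNdvd.
have /dvdnP[f df] : (e %| \dim_K {:F})%N.
  have [a aK Pa] := pval_onto P0.
  by have := vP0 a aK; rewrite vQ ?(subvP KE) // Pa mulr1 => /(congr1 absz); rewrite abszM /= => <-; apply: dvdn_mulr.
have leE : (f <= \dim_K E)%N.
  apply: (leq_dim_over Kd x0) => [j /andP[j0 je]||] //.
  by rewrite vx df dvdzE abszM /= dvdn_pmul2r // gtnNdvd.
apply/eqP; rewrite eqn_leq leF /=.
have := dim_over_tower KE; rewrite df => fe.
have f0 : (0 < f)%N by move: d0; rewrite df muln_gt0 => /andP[].
by rewrite -(leq_pmul2l f0) fe leq_mul2r leE orbT.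
Qed.

(** Stated up to an equation on [E], since the top of a tower of fields is only
    provably equal to [F]. *)
Lemma conj_place E (v : place {:F}%AS) (s : gal_of {:F}) : E = {:F}%AS ->
  exists Q : place E, forall z, Q z = v (s z).
Proof.
move=> EF; subst E.
have out z : (z \notin {:F}%AS) || (z == 0) -> v (s z) = 0.
  by rewrite memvf /= => /eqP ->; rewrite linear0 pval_out // eqxx orbT.
have hM : {in {:F}%AS &, forall a b, a != 0 -> b != 0 -> v (s (a * b)) = v (s a) + v (s b)}.
  by move=> a b _ _ a0 b0; rewrite rmorphM /= val_mul ?fmorph_eq0.
have hD : {in {:F}%AS &, forall a b, a != 0 -> b != 0 -> a + b != 0 ->
    Num.min (v (s a)) (v (s b)) <= v (s (a + b))}.
  move=> a b _ _ a0 b0 ab0; rewrite rmorphD /=.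
  by apply: pvalD; rewrite ?memvf -?rmorphD ?fmorph_eq0.
have hc c : v (s (const F c)) = 0.
  by rewrite /const linearZ /= rmorph1 pval_const.
have ho : exists2 t, t \in {:F}%AS & v (s t) = 1.
  have [t _ vt] := pval_onto v; exists ((s^-1)%g t); rewrite ?memvf //.
  by rewrite -galM ?memvf // mulVg gal_id.
by exists (Place out hM hD hc ho).
Qed.

(** From [z ^+ p = z] one gets [p * v z = v z]. *)
Lemma val_fixed_power (v : place {:F}%AS) p z : prime p -> z != 0 -> z ^+ p = z -> v z = 0.
Proof.
move=> p_pr z0 zp; have := val_exp v p z0; rewrite zp => /eqP.
rewrite -subr_eq0 -{1}[v z]mul1r -mulrBl mulf_eq0 => /orP[|/eqP//].
by rewrite subr_eq0 eqz_nat eq_sym gtn_eqF ?prime_gt1.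
Qed.

Lemma pchar_function_field p : p \in [pchar k] -> p \in [pchar F].
Proof.
move=> pk; apply: (rmorph_pchar (in_alg F)); apply: (rmorph_pchar (@tofrac {poly k})).
exact: (rmorph_pchar (@polyC k)).
Qed.

(** If [y] were integral, then [s y - y] would vanish at the place by inertia,
    whereas it is a unit.  So [y] has a pole, and [y ^+ p] dominates [y]. *)
Lemma val_artin_schreier K (d : nat) p (v : place {:F}%AS) (s : gal_of {:F}) y :
    (forall s z, s \in 'Gal({:F} / 1%AS)%g -> v (s z) = v z) ->
    prime p -> {in K, forall a, (d %| v a)%Z} -> (\dim_K {:F} <= d)%N ->
    s \in 'Gal({:F} / K)%g -> s y != y -> v (s y - y) = 0 ->
  v y < 0 /\ v (y ^+ p - y) = p%:Z * v y.
Proof.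
move=> vG p_pr Kd dimF sK sy vsy.
have [t _ vt] := pval_onto v.
have vy : v y < 0.
  rewrite ltNge; apply/negP => y0; have := val_ge_gal_sub vG Kd dimF vt sK (z := y).
  by rewrite /val_ge y0 orbT subr_eq0 (negPf sy) vsy => /(_ isT).
have y0 : y != 0 by apply: (val_neq0 (v := v)); rewrite lt_eqF.
split=> //; rewrite -val_exp //; apply: (proj2 (val_dominant _ _)); first exact: expf_neq0.
rewrite val_geN val_geE // val_exp // lezD1.
by rewrite -subr_gt0 -{1}[v y]mul1r -mulrBl nmulr_lgt0 // subr_lt0 ltz_nat prime_gt1.
Qed.

End Ramification.

(** The subgroups of a cyclic p-group form a chain, so a subgroup of [A] not
    contained in the maximal subgroup [B] is [A]. *)
Lemma cycle_outside_maximal (gT : finGroupType) (G A B : {group gT}) p a (s : gT) :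
    prime p -> cyclic G -> A \subset G -> B \subset G ->
    #|A| = (p ^ a.+1)%N -> #|B| = (p ^ a)%N -> s \in A -> s \notin B ->
  (<[s]> = A)%g.
Proof.
move=> p_pr cycG AG BG cA cB sA sB; have sAG : (<[s]> \subset A)%g by rewrite cycle_subG.
apply/eqP; rewrite eqEcard sAG cA /=.
have := cardSg sAG; rewrite cA => /(dvdn_pfactor _ _ p_pr)[m ma cs].
rewrite cs leq_exp2l ?prime_gt1 // ltnNge; apply: contra sB => lem.
by rewrite -cycle_subG -(cardSg_cyclic cycG) ?(subset_trans sAG) // cB cs dvdn_exp2l.
Qed.

(** * The jumps *)

(** The elements that move [t] by at least a given valuation form a group, by
    [s (s' t) - t = s (s' t - t) + (s t - t)]. *)
Lemma val_ge_cycle (k : closedFieldType) (F : splittingFieldType (ratfun k))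
    (v : place {:F}%AS) (s s' : gal_of {:F}) t m :
    (forall s z, s \in 'Gal({:F} / 1%AS)%g -> v (s z) = v z) ->
    s \in 'Gal({:F} / 1%AS)%g -> s' \in <[s]>%g -> val_ge v (s t - t) m ->
  val_ge v (s' t - t) m.
Proof.
move=> vG sG /cycleP[j ->] hs; elim: j => [|j IH].
  by rewrite expg0 gal_id subrr; apply: val_ge0.
rewrite expgSr galM ?memvf //.
have -> : s ((s ^+ j)%g t) - t = s ((s ^+ j)%g t - t) + (s t - t) by rewrite rmorphB /= addrA subrK.
by apply: val_geD => //; rewrite val_ge_gal.
Qed.

Lemma last_step (Q : nat -> bool) n : Q 0%N -> ~~ Q n ->
  exists2 nu, (nu < n)%N & Q nu && ~~ Q nu.+1.
Proof.
move=> Q0; elim: n => [|n IH]; first by rewrite Q0.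
have [Qn nQ|nQn _] := boolP (Q n); first by exists n; rewrite ?Qn.
by have [nu lt h] := IH nQn; exists nu; rewrite // ltnW.
Qed.

Lemma coeff_std_divisor (k : closedFieldType) (F : splittingFieldType (ratfun k))
    (E : {subfield F}) r (Q : 'I_r -> place E) (lam : 'I_r -> nat) (A : divisor E) i0 :
    injective Q ->
  coeff (Q i0) (A - \sum_(i < r) << (lam i)%:Z *g Q i >>) = coeff (Q i0) A - (lam i0)%:Z.
Proof.
move=> Qinj; rewrite coeffB raddf_sum /= (bigD1 i0) //= coeffU eqxx mulr1.
rewrite big1 ?addr0 // => i ii0; rewrite coeffU; case: eqP => [/Qinj e|]; last by rewrite mulr0.
by rewrite e eqxx in ii0.
Qed.

Theorem proposition32
  (k : closedFieldType) (p : nat) (charkp : p \in [pchar k])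
  (F : splittingFieldType (ratfun k))
  (* genus at least 2 *)
  (g : nat) (genusF : is_genus F g) (g_ge2 : (2 <= g)%N)
  (* F/k(x) is cyclic of degree p^n, with its tower of intermediate fields *)
  (n : nat) (dimF : \dim {:F} = (p ^ n)%N)
  (galF : galois 1%AS {:F}) (cycF : cyclic 'Gal({:F} / 1%AS))
  (L : nat -> {subfield F}) (L0 : L 0%N = 1%AS) (Ln : L n = {:F}%AS)
  (Lsub : forall nu, (nu < n)%N -> (L nu <= L nu.+1)%VS)
  (Ldeg : forall nu, (nu < n)%N -> \dim_(L nu) (L nu.+1) = p)
  (* every ramified place is totally ramified *)
  (ramtot : forall P0 : place (L 0%N), ramified P0 -> totally_ramified P0)
  (* Pl i 0 is the i-th ramified place of L 0, Pl i nu the place of L nu above *)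
  (r : nat) (Pl : 'I_r -> forall nu : nat, place (L nu))
  (Pl_inj : injective (fun i => Pl i 0%N))
  (Pl_ram : forall P0 : place (L 0%N), ramified P0 <-> exists i, P0 = Pl i 0%N)
  (Pl_above : forall i nu, (nu <= n)%N -> forall Q : place (L nu),
     lies_above Q (Pl i 0%N) <-> Q = Pl i nu)
  (* generators in standard form *)
  (y : nat -> F) (lam : 'I_r -> nat -> nat)
  (lam_p : forall i nu, (1 <= nu <= n)%N -> lam i nu = 0%N \/ coprime p (lam i nu))
  (y_gen : forall nu, (nu < n)%N -> L nu.+1 = <<L nu; y nu.+1>>%AS)
  (y_std : forall nu, (nu < n)%N ->
     let B := y nu.+1 ^+ p - y nu.+1 in
     exists A : divisor (L nu),
       [/\ effective A, prime_to_poles A B &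
           is_div B (A - \sum_(i < r) << (lam i nu.+1)%:Z *g Pl i nu >>)])
  (* P is totally ramified, above the i0-th ramified place; PP nu is the
     place of L nu below P; t is a local uniformizer at P *)
  (P : place {:F}%AS) (i0 : 'I_r) (P_tot : ram_index P (Pl i0 0%N) (p ^ n))
  (PP : forall nu : nat, place (L nu))
  (P_PP : forall nu, (nu <= n)%N -> lies_above P (PP nu))
  (t : F) (t_unif : P t = 1) :
  (forall nu, (1 <= nu <= n)%N -> PP nu (y nu) = - (lam i0 nu)%:Z) /\
  (forall j : int, is_jump (L 0%N) P t j <->
     exists2 nu, (1 <= nu <= n)%N & j = (lam i0 nu)%:Z).
Proof.
have p_pr : prime p by case/andP: charkp.
have charF := pchar_function_field F charkp.
have Lmono nu : (nu <= n)%N -> (L 0%N <= L nu)%VS.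
  elim: nu => // nu IH lt; exact: subv_trans (IH (ltnW lt)) (Lsub _ lt).
have dim0 : \dim_(L 0%N) {:F} = (p ^ n)%N by rewrite L0 dimv1 divn1.
have dimL nu : (nu <= n)%N -> \dim_(L nu) {:F} = (p ^ (n - nu))%N.
  elim: nu => [|nu IH] lt; first by rewrite subn0.
  have := dim_over_tower (Lsub _ lt); rewrite IH 1?ltnW // Ldeg // -(subnSK lt) expnS.
  by move/eqP; rewrite eqn_pmul2l ?prime_gt0 // => /eqP <-.
have PPl i nu : (nu <= n)%N -> lies_above (Pl i nu) (Pl i 0%N).
  by move=> lt; apply/Pl_above.
have Pl_inj' nu : (nu <= n)%N -> injective (fun i => Pl i nu).
  move=> lt i j eq_ij; apply: Pl_inj.
  have [e he] := PPl i nu lt; have [e' he'] := PPl j nu lt.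
  by apply: ram_index_inj he _; rewrite eq_ij; apply: he'.
have [pn0 PPl0] := P_tot.
(* The restriction of PP nu to L 0 is p^n / e times Pl i0 0. *)
have PPE nu : (nu <= n)%N -> PP nu = Pl i0 nu.
  move=> lt; apply/Pl_above => //; have [e [e0 Pe]] := P_PP nu lt.
  have [a aL Pa] := pval_onto (Pl i0 0%N).
  have /dvdnP[f fE] : (e %| p ^ n)%N.
    have := PPl0 a aL; rewrite Pe ?(subvP (Lmono _ lt)) // Pa mulr1.
    by move/(congr1 absz); rewrite abszM /= => <-; apply: dvdn_mulr.
  exists f; split; first by move: pn0; rewrite fE muln_gt0 => /andP[].
  move=> z zL; apply: (@mulfI _ e%:Z); first by rewrite -lt0n.
  by rewrite -Pe ?(subvP (Lmono _ lt)) // PPl0 // fE mulrA PoszM [e%:Z * _]mulrC.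
have ramP nu : (nu <= n)%N -> {in L nu, forall z, P z = (p ^ (n - nu))%N%:Z * PP nu z}.
  move=> lt; have [e he] := P_PP nu lt; rewrite -dimL //.
  rewrite -(totally_ramified_index (P0 := Pl i0 0%N) (Lmono _ lt) _ he) ?dim0 //.
  by case: he.
(* F has only one place above Pl i0 0, so it equals its conjugates. *)
have vG (s : gal_of {:F}) z : s \in 'Gal({:F} / 1%AS)%g -> P (s z) = P z.
  have conj (h : gal_of {:F}) : h \in 'Gal({:F} / 1%AS)%g -> forall z, Pl i0 n z = P (h z).
    move=> h1; have [Q QE] := conj_place P h Ln.
    suff <- : Q = Pl i0 n by [].
    apply/Pl_above => //; exists (p ^ n)%N; split=> // x xL.
    by rewrite QE (fixed_gal _ h1) ?sub1v -?L0 // PPl0.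
  by move=> s1; rewrite -(conj _ s1) (conj 1%g) ?group1 // gal_id.
have t0 : t != 0 by apply: (val_neq0 (v := P)); rewrite t_unif.
have PL nu : (nu <= n)%N -> {in L nu, forall z, ((p ^ (n - nu))%N %| P z)%Z}.
  by move=> lt z zL; rewrite (ramP _ lt) //; apply: dvdz_mulr.
have cardL nu : (nu <= n)%N -> #|'Gal({:F} / L nu)%g| = (p ^ (n - nu))%N.
  move=> lt; rewrite -dimL // galois_dim //.
  by apply: galoisS galF; rewrite sub1v subvf.
have unitF (j : nat) : coprime p j -> j%:R != 0 :> F /\ P j%:R = 0.
  move=> pj; have j0 : j%:R != 0 :> F by rewrite -(dvdn_pcharf charF) -prime_coprime.
  split=> //; apply: (val_fixed_power P p_pr j0).
  by rewrite -(pFrobenius_autE charF) rmorph_nat.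
(* The order of the pole is read off from the standard form only once the pole
   is known to exist: elsewhere the coefficient of A may cancel lam. *)
have step nu (lt : (nu < n)%N) (s : gal_of {:F}) :
    s \in 'Gal({:F} / L nu)%g -> s \notin 'Gal({:F} / L nu.+1)%g ->
    [/\ s (y nu.+1) != y nu.+1, P (s (y nu.+1) - y nu.+1) = 0,
        (0 < lam i0 nu.+1)%N, coprime p (lam i0 nu.+1) &
        P (y nu.+1) = - (lam i0 nu.+1 * p ^ (n - nu.+1))%N%:Z].
  move=> sL sL'; set z := y nu.+1.
  have [A [_ ppA [BL B0 dB]]] := y_std nu lt; set B := z ^+ p - z in ppA BL B0 dB.
  have sz : s z != z.
    apply: contra sL' => /eqP sz; rewrite y_gen // gal_kHom ?subvf //.
    apply/kAHomP => x /Fadjoin_polyP[q qL ->].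
    by rewrite -horner_map (fixedPoly_gal (subvf _) sL qL) /= sz.
  have vsz : P (s z - z) = 0.
    apply: (val_fixed_power P p_pr); first by rewrite subr_eq0.
    (* s y and y are roots of X^p - X - B, whose roots differ by those of X^p - X *)
    have sB : s B = B := fixed_gal (subvf _) sL BL.
    rewrite -(pFrobenius_autE charF) rmorphB /= !pFrobenius_autE.
    have : s z ^+ p - s z = z ^+ p - z by rewrite -[RHS]sB rmorphB rmorphXn.
    move/eqP; rewrite subr_eq => /eqP ->; ring.
  have [vz vB] := val_artin_schreier vG p_pr (PL _ (ltnW lt)) (eq_leq (dimL _ (ltnW lt))) sL sz vsz.
  have vPB : PP nu B < 0.
    have : P B < 0 by rewrite vB nmulr_llt0 // ltz_nat prime_gt0.
    by rewrite (ramP _ (ltnW lt)) // pmulr_rlt0 // ltz_nat expn_gt0 prime_gt0.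
  have lamB : PP nu B = - (lam i0 nu.+1)%:Z.
    have := dB (PP nu); rewrite {1}PPE 1?ltnW // coeff_std_divisor; last exact/Pl_inj'/ltnW.
    by rewrite -PPE 1?ltnW // ppA // sub0r => ->.
  have lam0 : (0 < lam i0 nu.+1)%N by move: vPB; rewrite lamB oppr_lt0 ltz_nat.
  split=> //.
    by case: (lam_p i0 nu.+1) => // e0; rewrite e0 in lam0.
  apply: (@mulfI _ p%:Z); first by rewrite -lt0n prime_gt0.
  rewrite -vB (ramP _ (ltnW lt)) // lamB -(subnSK lt) expnS !PoszM !mulrN; congr (- _).
  by rewrite -mulrA; congr (_ * _); rewrite mulrC.
have jump nu (lt : (nu < n)%N) (s : gal_of {:F}) :
    s \in 'Gal({:F} / L nu)%g -> s \notin 'Gal({:F} / L nu.+1)%g ->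
    s t != t /\ P (s t - t) = (lam i0 nu.+1)%:Z + 1.
  move=> sL sL'.
  have gen h : h \in 'Gal({:F} / L nu)%g -> h \notin 'Gal({:F} / L nu.+1)%g ->
      <[h]>%g = 'Gal({:F} / L nu)%g.
    apply: (cycle_outside_maximal (a := n - nu.+1) p_pr cycF); rewrite ?gal_sub1 ?cardL //.
      by rewrite subnSK.
    exact: ltnW.
  have Gsub h : h \in 'Gal({:F} / L nu)%g -> h \in 'Gal({:F} / 1%AS)%g.
    by apply/subsetP/gal_sub1.
  have nt h : h \in 'Gal({:F} / L nu)%g -> h \notin 'Gal({:F} / L nu.+1)%g -> h t != t.
    move=> hL hL'; apply: contra hL' => /eqP ht.
    have td (j : nat) : (0 < j < p ^ n)%N -> ~~ ((p ^ n)%N %| j%:Z * P t)%Z.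
      by move=> /andP[j0 jd]; rewrite t_unif mulr1 dvdzE /= gtnNdvd.
    have PL0 := PL 0%N (leq0n n); rewrite subn0 in PL0.
    have Kt : <<L 0%N; t>>%VS = fullv.
      by apply: (adjoin_full PL0 t0 td (E := {:F}%AS)); rewrite ?subvf ?memvf ?dim0.
    suff -> : h = 1%g by apply: group1.
    by apply: (gal_inj_on Kt); rewrite ?group1 ?gal_id // L0 Gsub.
  (* any two such elements are powers of each other *)
  have valle h h' : h \in 'Gal({:F} / L nu)%g -> h \notin 'Gal({:F} / L nu.+1)%g ->
      h' \in 'Gal({:F} / L nu)%g -> h' \notin 'Gal({:F} / L nu.+1)%g ->
      P (h t - t) <= P (h' t - t).
    move=> hL hL' h'L h'L'.
    rewrite -val_geE ?subr_eq0 ?nt //; apply: (val_ge_cycle vG (Gsub _ hL)).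
      by rewrite gen.
    exact: val_ge_refl.
  split; first exact: nt.
  have [sy vsy lam0 plam vy] := step nu lt s sL sL'.
  have PPn := PL _ (ltnW lt); rewrite -(subnSK lt) expnS in PPn.
  have [tau tauL PPtau] := pval_onto (PP nu).
  have Ptau : P tau = (p * p ^ (n - nu.+1))%N.
    by rewrite (ramP _ (ltnW lt)) // PPtau mulr1 -expnS subnSK.
  have N0 : (0 < p ^ (n - nu.+1))%N by rewrite expn_gt0 prime_gt0.
  have degy : (adjoin_degree (L nu) (y nu.+1) <= p)%N.
    by rewrite adjoin_degreeE -(Ldeg _ lt) y_gen.
  apply: (artin_schreier_jump vG p_pr N0 lam0 plam PPn degy vy sL sy vsy unitF galF _ _ _ tauL Ptau t_unif).
  - exact: y_gen.
  - by rewrite (dimL _ (ltnW lt)) -(subnSK lt) expnS.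
  - exact: cardL.
  move=> h hL; have hL0 : h \in 'Gal({:F} / L nu)%g by apply: subsetP hL; apply/galS/Lsub.
  have hsL : (h * s)%g \in 'Gal({:F} / L nu)%g by rewrite groupM.
  have hsL' : (h * s)%g \notin 'Gal({:F} / L nu.+1)%g by rewrite groupMl.
  rewrite -galM ?memvf //; split; first exact: nt.
  by apply/eqP; rewrite eq_le !valle.
have outside nu : (nu < n)%N ->
    exists2 s, s \in 'Gal({:F} / L nu)%g & s \notin 'Gal({:F} / L nu.+1)%g.
  move=> lt; apply/subsetPn; apply/negP => /subset_leq_card.
  rewrite (cardL _ lt) (cardL _ (ltnW lt)) leq_exp2l ?prime_gt1 //.
  by rewrite -(subnSK lt) ltnn.
split=> [[|nu] // /andP[_ lt]|j].
  have [s sL sL'] := outside nu lt; have [_ _ _ _ vy] := step nu lt s sL sL'.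
  apply: (@mulfI _ (p ^ (n - nu.+1))%N%:Z); first by rewrite -lt0n expn_gt0 prime_gt0.
  by rewrite -ramP ?y_gen ?memv_adjoin // vy mulrN mulnC PoszM.
split.
  case/properP=> _ [s]; rewrite !inE => /andP[sL sj]; rewrite sL /= => nsj.
  have st : s t - t != 0 by apply: contra nsj => /eqP ->; apply: val_ge0.
  have [nu lt /andP[sLnu sLnu']] : exists2 nu, (nu < n)%N &
      (s \in 'Gal({:F} / L nu)%g) && (s \notin 'Gal({:F} / L nu.+1)%g).
    apply: (last_step (Q := fun nu => s \in 'Gal({:F} / L nu)%g)) => //.
    have := cardL n (leqnn n); rewrite subnn expn0 => /eqP; rewrite -trivg_card1 => /eqP ->.
    by apply: contra st; rewrite inE => /eqP ->; rewrite gal_id subrr.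
  have [_ vst] := jump nu lt s sLnu sLnu'.
  exists nu.+1 => //; move: sj nsj; rewrite !val_geE // vst !lerD2r lezD1 -leNgt.
  by move=> jl lj; apply/eqP; rewrite eq_le jl lj.
case=> -[|nu] // /andP[_ lt] ->.
have [s sL sL'] := outside nu lt; have [st vst] := jump nu lt s sL sL'.
apply/properP; split.
  apply/subsetP => h; rewrite !inE => /andP[-> /=]; by apply: val_ge_le; rewrite lerDl.
have sL0 : s \in 'Gal({:F} / L 0%N)%g.
  by apply: subsetP sL; apply/galS/Lmono/ltnW.
by exists s; rewrite !inE sL0 /= val_geE ?subr_eq0 // vst ?lexx ?lezD1 ?ltxx.
Qed.
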